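(* If $Sp(K,S)$ is a split graph with biadjacency matrix $R$ and $\operatorname{Supp}(Sp)\cap K\ne\varnothing$, then \[\operatorname{nl}(Sp)=\operatorname{nl}(R)+1.\]
   Context: Graphs are finite and simple. A split graph is a graph $Sp$ whose vertex set is a disjoint union of a clique $K$ and an independent set $S$; the pair $(K,S)$ is called an s-partition, and $Sp(K,S)$ denotes $Sp$ together with this s-partition. Both $K$ and $S$ are assumed nonempty. With the vertices ordered as $(K,S)$, the adjacency matrix is \[A(Sp)=\begin{pmatrix} J-I & R\\ R^t & 0\end{pmatrix},\] where $J$ is an all-ones matrix, $I$ the identity, and $R$ is the $|K|\times|S|$ $0/1$ biadjacency matrix ($R_{uv}=1$ iff $u\in K$ and $v\in S$ are adjacent). $\operatorname{nl}(A)$ is the dimension of the nullspace of a real matrix $A$ and $\operatorname{nl}(Sp)=\operatorname{nl}(A(Sp))$. $\operatorname{Supp}(Sp)$ is the set of vertices $v$ such that $x_v\ne 0$ for some $x$ in the nullspace of $A(Sp)$. *)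

(* Defs.v *)
From HB Require Import structures.
From mathcomp Require Import all_boot all_order all_algebra reals.

Set Implicit Arguments.
Unset Strict Implicit.
Unset Printing Implicit Defensive.

Import GRing.Theory.
Local Open Scope ring_scope.

Record sgraph := SGraph {
  vertex :> finType;
  adj : rel vertex;
  adj_sym : symmetric adj;
  adj_irrefl : irreflexive adj
}.

Definition clique (G : sgraph) (K : {set G}) : Prop :=
  {in K &, forall u v, u != v -> adj u v}.

Definition independent (G : sgraph) (S : {set G}) : Prop :=
  {in S &, forall u v, ~~ adj u v}.

Definition s_partition (G : sgraph) (K S : {set G}) : Prop :=
  [/\ K :|: S = setT, [disjoint K & S], clique K & independent S]
  /\ (K != set0 /\ S != set0).

(* The i-th row and column correspond to the i-th vertex of [enum G]; a
   different ordering of the vertices conjugates this matrix by a permutation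
   matrix, which affects neither [nullity] nor [in_supp] below. *)
Definition adjmx (R : realType) (G : sgraph) : 'M[R]_#|G| :=
  \matrix_(i, j) (adj (enum_val i) (enum_val j))%:R.

Definition biadjmx (R : realType) (G : sgraph) (K S : {set G}) :
    'M[R]_(#|K|, #|S|) :=
  \matrix_(i, j) (adj (enum_val i) (enum_val j))%:R.

(* The columns of [cokermx A] span the right nullspace {x | A *m x = 0}
   (whereas [kermx A] gives the left one); the side matters as [biadjmx] need
   not be square. *)
Definition nullity (R : realType) (m n : nat) (A : 'M[R]_(m, n)) : nat :=
  \rank (cokermx A).

Definition in_supp (R : realType) (G : sgraph) (v : G) : Prop :=
  exists x : 'cV[R]_#|G|, adjmx R G *m x = 0 /\ x (enum_rank v) 0 != 0.

(* Main.v *)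
(* A null vector (x, y) of the adjacency matrix satisfies (J - I) x + R y = 0
   and R^T x = 0, hence x^T (J - I) x = 0, that is, (sum x)^2 = |x|^2. So x is
   determined by the sum of its entries: the K-components of null vectors form
   a space of dimension at most 1, and exactly 1 when the support meets K. The
   null vectors with x = 0 are those with R y = 0. *)
Require Import Defs.
From mathcomp Require Import all_boot all_order all_algebra reals.

Set Implicit Arguments.
Unset Strict Implicit.
Unset Printing Implicit Defensive.

Import Order.TTheory GRing.Theory Num.Theory.
Local Open Scope ring_scope.

(** Both sides are the number of columns minus the rank. Null vectors thus become rows of a [kermx],
    to which the row-space calculus applies. *)
Lemma nullityE (R : realType) (m n : nat) (A : 'M[R]_(m, n)) :
  nullity A = \rank (kermx A^T).
Proof. by rewrite /nullity mxrank_coker mxrank_ker mxrank_tr. Qed.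

Lemma mulmx_tr_eq0 (F : realFieldType) (n : nat) (x : 'rV[F]_n) :
  x *m x^T = 0 -> x = 0.
Proof.
move=> /matrixP/(_ 0 0); rewrite !mxE => /eqP.
rewrite psumr_eq0 => [/allP x0|i _]; last by rewrite mxE -expr2 sqr_ge0.
apply/rowP => j; rewrite mxE; apply/eqP.
by have := x0 j (mem_index_enum _); rewrite /= mxE mulf_eq0 orbb.
Qed.

Section BlockMatrix.
Variables (R : realType) (k s : nat) (C : 'M[R]_(k, s)).

Definition split_mx : 'M[R]_(k + s) :=
  block_mx (const_mx 1 - 1%:M) C C^T 0.

Lemma split_mx_tr : split_mx^T = split_mx.
Proof.
by rewrite /split_mx tr_block_mx linearB /= trmx_const tr_scalar_mx trmx0 trmxK.
Qed.

Lemma row_mx_split_mx_eq0 (x : 'rV[R]_k) (y : 'rV[R]_s) :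
  row_mx x y *m split_mx = 0 <->
  x *m const_mx 1 - x + y *m C^T = 0 /\ x *m C = 0.
Proof.
rewrite /split_mx mul_row_block mulmx0 addr0 mulmxBr mulmx1.
split=> [/eqP|[-> ->]]; last by rewrite row_mx0.
by rewrite row_mx_eq0 => /andP[/eqP-> /eqP->].
Qed.

Lemma null_split_mx_sum0 (x : 'rV[R]_k) (y : 'rV[R]_s) :
  row_mx x y *m split_mx = 0 -> x *m const_mx 1 = 0 :> 'cV_1 -> x = 0.
Proof.
move=> /row_mx_split_mx_eq0[xy xC] sx.
have xJ : x *m (const_mx 1 : 'M_k) = 0.
  apply/rowP=> j; have /matrixP/(_ 0 0) := sx; rewrite !mxE => {2}<-.
  by apply: eq_bigr => i _; rewrite !mxE.
(* With [x J = 0] the first equation reads [x = y C^T], so [x x^T = y (x C)^T = 0]. *)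
apply: mulmx_tr_eq0; move: xy; rewrite xJ sub0r => /(congr1 (mulmx^~ x^T)).
by rewrite mulmxDl mulNmx -mulmxA -trmx_mul xC trmx0 mulmx0 addr0 mul0mx
           => /eqP; rewrite oppr_eq0 => /eqP.
Qed.

(** Rank-nullity for the projection [P] to the first [k] coordinates, restricted to the null space
    [W]: the image is a line and the kernel is a copy of the null space of [C]. *)
Lemma nullity_split_mx (x : 'rV[R]_k) (y : 'rV[R]_s) :
  row_mx x y *m split_mx = 0 -> x != 0 ->
  nullity split_mx = (nullity C + 1)%N.
Proof.
move=> xy0 x_neq0; rewrite !nullityE split_mx_tr.
set W := kermx split_mx; pose P : 'M[R]_(k + s, k) := col_mx 1%:M 0.
have mulP u v : row_mx u v *m P = u :> 'rV_k.
  by rewrite mul_row_col mulmx1 mulmx0 addr0.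
have rankWP : \rank (W *m P) = 1%N.
  apply/eqP; rewrite eqn_leq; apply/andP; split; last first.
    rewrite lt0n mxrank_eq0; apply: contraNneq x_neq0 => WP0.
    have /submxP[D xyD] : (row_mx x y <= W)%MS by apply/sub_kermxP.
    by rewrite -(mulP x y) xyD -mulmxA WP0 mulmx0.
  (* The coordinate sum maps the image of [P] to a one-dimensional space, and it is injective there
     by [null_split_mx_sum0]; hence the rank is at most 1. *)
  rewrite -(mxrank_mul_ker (W *m P) (const_mx 1 : 'cV_k)).
  rewrite [X in (_ + X)%N](_ : _ = 0)%N ?addn0 ?rank_leq_col //.
  apply/eqP; rewrite mxrank_eq0 -submx0; apply/rV_subP => u.
  rewrite sub_capmx => /andP[/submxP[D uD] /sub_kermxP u1].
  have: D *m W *m split_mx = 0 by rewrite -mulmxA mulmx_ker mulmx0.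
  move: uD; rewrite mulmxA -(hsubmxK (D *m W)) mulP => <- /null_split_mx_sum0.
  by move=> /(_ u1)->; rewrite sub0mx.
rewrite -(mxrank_mul_ker W P) rankWP addnC; congr (_ + 1)%N.
(* [Q] is the embedding of [y] as [(0, y)]; it carries the kernel of [C^T] onto the part of [W]
   killed by [P]. *)
pose Q : 'M[R]_(s, k + s) := row_mx 0 1%:M.
have freeQ : row_free Q.
  by apply/row_freeP; exists Q^T; rewrite tr_row_mx mul_row_col trmx0 mulmx0
    add0r trmx1 mulmx1.
rewrite -(mxrankMfree (kermx C^T) freeQ); apply: eqmx_rank.
apply/andP; split; apply/rV_subP => u.
  rewrite -(hsubmxK u) sub_capmx => /andP[/sub_kermxP uW /sub_kermxP].
  rewrite mulP => u0; move: uW; rewrite u0 => /row_mx_split_mx_eq0[].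
  rewrite mul0mx subr0 add0r => /sub_kermxP/submxP[D ->] _.
  apply/submxP; exists D.
  by rewrite mulmxA mul_mx_row mulmx0 mulmx1.
move=> /submxP[D ->]; rewrite mulmxA mul_mx_row mulmx0 mulmx1 sub_capmx.
apply/andP; split; apply/sub_kermxP; rewrite ?mulP //.
by apply/row_mx_split_mx_eq0; rewrite !mul0mx subr0 add0r -mulmxA mulmx_ker mulmx0.
Qed.

End BlockMatrix.

Section Selection.
Variables (R : realType) (T : finType).

(** The rows of the identity indexed by [A]: left multiplication restricts a vector to its
    coordinates in [A]. *)
Definition sel_mx (A : {set T}) : 'M[R]_(#|A|, #|T|) :=
  \matrix_(i, j) (enum_val i == enum_val j)%:R.

Lemma mul_sel_mx (A : {set T}) n (M : 'M[R]_(#|T|, n)) i j :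
  (sel_mx A *m M) i j = M (enum_rank (enum_val i)) j.
Proof.
rewrite mxE (bigD1 (enum_rank (enum_val i))) //= mxE enum_rankK eqxx mul1r.
rewrite big1 ?addr0 // => l li; rewrite mxE (_ : _ == _ = false) ?mul0r //.
by apply: contraNF li => /eqP->; rewrite enum_valK.
Qed.

Lemma mul_tr_sel_mx (A : {set T}) n (M : 'M[R]_(n, #|T|)) i j :
  (M *m (sel_mx A)^T) i j = M i (enum_rank (enum_val j)).
Proof. by rewrite -[M]trmxK -trmx_mul mxE mul_sel_mx !mxE. Qed.

(** Each Gram matrix is the diagonal indicator of its set, and the two indicators add up to 1. The
    stacked matrix is a permutation matrix up to the type of its row index. *)
Lemma sel_mx_partition (A B : {set T}) :
  A :|: B = setT -> [disjoint A & B] ->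
  (col_mx (sel_mx A) (sel_mx B))^T *m col_mx (sel_mx A) (sel_mx B) = 1%:M.
Proof.
move=> AB dAB; rewrite tr_col_mx mul_row_col.
have selE (D : {set T}) i j : ((sel_mx D)^T *m sel_mx D) i j
    = ((enum_val i \in D) && (i == j))%:R.
  rewrite mxE; under eq_bigr do rewrite !mxE -natrM mulnb.
  have [iD|iD] /= := boolP (enum_val i \in D); last first.
    rewrite big1 // => l _; case: eqP => // li.
    by rewrite -li enum_valP in iD.
  rewrite (bigD1 (enum_rank_in iD (enum_val i))) //= enum_rankK_in // eqxx /=.
  rewrite (inj_eq enum_val_inj) big1 ?addr0 // => l.
  case: (eqVneq (enum_val l) (enum_val i)) => //= e /eqP[].
  by apply: enum_val_inj; rewrite enum_rankK_in.
apply/matrixP => i j; rewrite mxE !selE mxE.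
have: enum_val i \in A :|: B by rewrite AB.
rewrite inE; have [iA _|_ /= ->] := boolP (_ \in A); last by rewrite add0r.
by rewrite (disjointFr dAB iA) addr0.
Qed.

End Selection.

(** Multiplying by [U^T] and [U] recovers [A], so neither product loses rank. Keeping [m] and [n]
    distinct avoids a cast between [#|K| + #|S|] and [#|Sp|]. *)
Lemma mxrank_congr (F : fieldType) (m n : nat) (U : 'M[F]_(m, n)) (A : 'M[F]_n) :
  U^T *m U = 1%:M -> \rank (U *m A *m U^T) = \rank A.
Proof.
move=> UU; have AE : A = U^T *m (U *m A *m U^T *m U).
  by rewrite -2!mulmxA UU mulmx1 mulmxA UU mul1mx.
apply/eqP; rewrite eqn_leq; apply/andP; split.
  exact: leq_trans (mxrankM_maxl _ _) (mxrankM_maxr _ _).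
by rewrite {1}AE; apply: leq_trans (mxrankM_maxr _ _) (mxrankM_maxl _ _).
Qed.

Lemma split_adjmx (R : realType) (G : sgraph) (K S : {set G}) :
  clique K -> independent S ->
  col_mx (sel_mx R K) (sel_mx R S) *m adjmx R G
    *m (col_mx (sel_mx R K) (sel_mx R S))^T = split_mx (biadjmx R K S).
Proof.
move=> cK iS; rewrite tr_col_mx mul_col_mx mul_col_row /split_mx.
congr block_mx; apply/matrixP => i j;
  rewrite mul_tr_sel_mx mul_sel_mx !mxE !enum_rankK //.
- have [->|ij] := eqVneq i j; first by rewrite adj_irrefl subrr.
  by rewrite cK ?enum_valP ?(inj_eq enum_val_inj) // subr0.
- by rewrite adj_sym.
- by rewrite (negbTE (iS _ _ _ _)) ?enum_valP.
Qed.

Theorem theorem5p3 (R : realType) (Sp : sgraph) (K S : {set Sp})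
  (hKS : s_partition K S)
  (hsupp : exists v : Sp, in_supp R v /\ v \in K) :
  nullity (adjmx R Sp) = (nullity (biadjmx R K S) + 1)%N.
Proof.
case: hKS => [[KS dKS cK iS] _]; case: hsupp => v [[x [Ax xv]] vK].
have UU := sel_mx_partition R KS dKS.
set U := col_mx _ _ in UU.
have UAU : U *m adjmx R Sp *m U^T = split_mx (biadjmx R K S) by exact: split_adjmx.
have cardKS : #|Sp| = (#|K| + #|S|)%N.
  by rewrite -cardsT -KS cardsU disjoint_setI0 // cards0 subn0.
have -> : nullity (adjmx R Sp) = nullity (split_mx (biadjmx R K S)).
  by rewrite /nullity !mxrank_coker -UAU mxrank_congr // -cardKS.
(* The required null vector is [U x], written as a row; its [K]-part is nonzero because its entry at
   [v] is the nonzero entry of [x] there. *)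
apply: (@nullity_split_mx _ _ _ _ (sel_mx R K *m x)^T (sel_mx R S *m x)^T).
  rewrite -tr_col_mx -mul_col_mx -/U -split_mx_tr -trmx_mul -UAU.
  by rewrite -!mulmxA (mulmxA U^T) UU mul1mx Ax mulmx0 trmx0.
apply: contraNneq xv => /rowP/(_ (enum_rank_in vK v)).
by rewrite mxE mul_sel_mx enum_rankK_in // mxE => ->.
Qed.
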